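(* Let $p$ be an odd prime and let $G$ be a finite $p$-group satisfying at least one of the following conditions: (i) $\gamma_m(G)\subseteq G^{p}$ for some integer $m$ with $2\leq m\leq p-1$; (ii) $\gamma_p(G)\subseteq G^{p^2}$. Then $\exp(G\wedge G)$ divides $\exp(G)$; hence $\exp(M(G))$ divides $\exp(G)$.
   Context: $\gamma_k(G)$ denotes the $k$-th term of the lower central series of $G$ ($\gamma_1(G)=G$, $\gamma_{k+1}(G)=[\gamma_k(G),G]$), and $G^{p^j}$ is the subgroup generated by all $p^j$-th powers. Conventions: ${}^g h = ghg^{-1}$, $[g,h]=ghg^{-1}h^{-1}$. The nonabelian tensor square $G\otimes G$ is generated by symbols $g\otimes h$ subject to $gg'\otimes h=({}^g g'\otimes {}^g h)(g\otimes h)$ and $g\otimes hh'=(g\otimes h)({}^h g\otimes {}^h h')$. The exterior square $G\wedge G$ is the quotient of $G\otimes G$ by the subgroup generated by all $x\otimes x$; $M(G)$ is the kernel of the map $G\wedge G\to[G,G]$, $g\wedge h\mapsto[g,h]$, and is isomorphic to $H_2(G,\mathbb{Z})$. *)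

(* Defs.v *)
From mathcomp Require Import all_boot all_fingroup all_solvable.
Set Implicit Arguments. Unset Strict Implicit. Unset Printing Implicit Defensive.
Local Open Scope group_scope.

(* Nonabelian exterior square G /\ G, encoded as the group presented by
   generators g /\ h (g,h in G) and the relations of the context.
   A letter (g,h,false) stands for the generator g/\h, (g,h,true) for its
   inverse; a word (seq of letters) stands for the product of its letters
   from left to right.  [wedge_eq G u v] is the congruence on words generated
   by the free-group cancellations and the defining relations, so the
   presented group is words-in-G modulo wedge_eq G. *)

Section Wedge.
Variable gT : finGroupType.

Definition letter := (gT * gT * bool)%type.

Definition lconj (g h : gT) : gT := g * h * g^-1.

Definition gen (g h : gT) : letter := (g, h, false).

Inductive wedge_eq (G : {set gT}) : seq letter -> seq letter -> Prop :=
| we_refl w : wedge_eq G w w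
| we_sym u v : wedge_eq G u v -> wedge_eq G v u
| we_trans u v w : wedge_eq G u v -> wedge_eq G v w -> wedge_eq G u w
| we_ctx a u v b : wedge_eq G u v -> wedge_eq G (a ++ u ++ b) (a ++ v ++ b)
| we_cancel g h (b : bool) : g \in G -> h \in G ->
    wedge_eq G [:: (g, h, b); (g, h, ~~ b)] [::]
| we_left g g' h : g \in G -> g' \in G -> h \in G ->
    wedge_eq G [:: gen (g * g') h] [:: gen (lconj g g') (lconj g h); gen g h]
| we_right g h h' : g \in G -> h \in G -> h' \in G ->
    wedge_eq G [:: gen g (h * h')] [:: gen g h; gen (lconj h g) (lconj h h')]
| we_diag g : g \in G -> wedge_eq G [:: gen g g] [::].

Definition wedge_word (G : {set gT}) (w : seq letter) : bool :=
  all (fun l : letter => (l.1.1 \in G) && (l.1.2 \in G)) w.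

Definition wpow (w : seq letter) (n : nat) : seq letter := flatten (nseq n w).

(* the map G /\ G -> [G,G], g /\ h |-> [g,h] = g h g^-1 h^-1 *)
Definition letter_val (l : letter) : gT :=
  let c := l.1.1 * l.1.2 * l.1.1^-1 * l.1.2^-1 in if l.2 then c^-1 else c.

Definition word_val (w : seq letter) : gT := foldr (fun l x => letter_val l * x) 1 w.

End Wedge.

Definition powsub (gT : finGroupType) (G : {set gT}) (n : nat) : {set gT} :=
  <<[set x ^+ n | x in G]>>.

(* Main.v *)
(* Let W_k be the subgroup of G /\ G generated by the x /\ y with x in
   gamma_(k+1)(G), so that W_0 = G /\ G and [W_k, G] = W_(k+1) inside the
   semidirect product of G /\ G with G. Since g |-> (g /\ y)^-1 g is a
   homomorphism into that product, x^n /\ y = x^n (x^-1 (x /\ y))^n, and the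
   Hall-Petrescu formula expands the right-hand side as (x /\ y)^n times powers
   c_i^binom(n, i) with c_i in W_(k+i-1). With n = p^e = exp G the left-hand
   side is trivial, so exp W_k divides p^e as soon as exp W_(k+1) does and
   W_(k+p^j-1) has exponent dividing p^(e-j).

   The latter is what the hypothesis on G is for: applied to n = p or n = p^2
   the same formula puts W_(k+p-2) inside B_k = <W_k^p, W_(k+p-1)> in case (i),
   and W_(k+p-1) inside B_k = <W_k^(p^2), W_(k+p-1)^p, W_(k+p)> in case (ii).
   The B_k form a central series as well, and by downward induction on k, with
   the Hall-Petrescu formula in B_k, if W_k has exponent dividing p^f then B_k
   has exponent dividing p^(f-1), resp. p^(f-2). *)

From HB Require Import structures.
Require Import Defs.
From mathcomp Require Import all_boot all_fingroup all_solvable.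
From mathcomp Require Import generic_quotient zify boolp.
Set Implicit Arguments. Unset Strict Implicit. Unset Printing Implicit Defensive.
Local Open Scope group_scope.

Ltac free_group :=
  rewrite /commg /conjg ?(invMg, invgK, invg1) -?mulgA;
  rewrite ?(mulKg, mulVKg, mulVg, mulgV, mulg1, mul1g, invg1).

(** * Subgroups of an arbitrary group, given as predicates *)

Section Subgroups.
Variable S : groupType.
Implicit Types (Q : S -> Prop) (x y : S).

Record subgroup Q : Prop := Subgroup {
  sub1 : Q 1;
  subM : forall x y, Q x -> Q y -> Q (x * y);
  subV : forall x, Q x -> Q x^-1 }.

Lemma subX Q x n : subgroup Q -> Q x -> Q (x ^+ n).
Proof.
move=> sQ Qx; elim: n => [|n IHn]; first exact: sub1.
by rewrite expgS; apply: subM.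
Qed.

Lemma sub_invE Q x : subgroup Q -> Q x^-1 -> Q x.
Proof. by move=> sQ /(subV sQ); rewrite invgK. Qed.

Lemma subgroup_trivial : subgroup (fun x : S => x = 1).
Proof.
split=> // [x y -> -> | x ->]; first by rewrite mulg1.
exact: invg1.
Qed.

End Subgroups.

(** * Polynomial sequences in a filtered group and the Hall-Petrescu formula *)

Section PolynomialSequences.
Variables (S : groupType) (F : nat -> S -> Prop).
Hypothesis sF : forall i, subgroup (F i).
Hypothesis decF : forall i x, F i.+1 x -> F i x.
Hypothesis commF :
  forall i j x y, F i x -> F j y -> F (i + j) [~ x, y].

Definition diff (f : nat -> S) n := (f n)^-1 * f n.+1.

(* Leibman's polynomial sequences, tested on the first [J] differences only,
   so that closure properties follow by a plain induction on [J]. *)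
Fixpoint poly J d (f : nat -> S) : Prop :=
  (forall n, F d (f n)) /\ (if J is J'.+1 then poly J' d.+1 (diff f) else True).

Lemma poly_ext J d f g : f =1 g -> poly J d f -> poly J d g.
Proof.
elim: J d f g => [|J IHJ] d f g fg /= [Ff Pf]; split=> //.
- by move=> n; rewrite -fg.
- by move=> n; rewrite -fg.
by apply: IHJ Pf => n; rewrite /diff !fg.
Qed.

Lemma poly_val J d f n : poly J d f -> F d (f n).
Proof. by case: J => [|J] /= []. Qed.

Lemma poly_pred J d f : poly J.+1 d f -> poly J d f.
Proof. by elim: J d f => [|J IHJ] d f /= [Ff Pf]; split=> //; apply: IHJ. Qed.

Lemma poly_decS J d f : poly J d.+1 f -> poly J d f.
Proof.
elim: J d f => [|J IHJ] d f /= [Ff Pf]; split; auto.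
Qed.

Lemma poly_dec J d e f : d <= e -> poly J e f -> poly J d f.
Proof.
move=> /subnK <-; elim: (e - d) => // m IHm.
by rewrite addSn => /poly_decS /IHm.
Qed.

Lemma diffM f g :
  diff (fun n => f n * g n) =1
  (fun n => diff f n * ([~ diff f n, g n] * diff g n)).
Proof. by move=> n; rewrite /diff; free_group. Qed.

Lemma commMl (a b c : S) : [~ a * b, c] = [~ a, c] * ([~ [~ a, c], b] * [~ b, c]).
Proof. by free_group. Qed.

Lemma commMr (a c d : S) : [~ a, c * d] = [~ a, d] * ([~ a, c] * [~ [~ a, c], d]).
Proof. by free_group. Qed.

(** Discrete Leibniz rule: every factor on the right involves [diff f n] or [diff g n], which gains
    one filtration step over [[~ f n, g n]]. *)
Lemma diffR f g n (c := [~ f n, g n])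
    (u := [~ f n, diff g n]) (e := u * ([~ u, c] * [~ c, diff g n])) :
  diff (fun n => [~ f n, g n]) n =
  e * (([~ c, diff f n] * ([~ [~ c, diff f n], e] * [~ e, diff f n])) *
       ([~ diff f n, diff g n] *
         ([~ diff f n, g n] * [~ [~ diff f n, g n], diff g n]))).
Proof.
have fD h : h n.+1 = h n * diff h n by rewrite /diff mulVKg.
have cE : [~ f n, g n.+1] = c * e.
  by rewrite fD /e /u /c; free_group.
have -> : diff (fun m => [~ f m, g m]) n = c^-1 * [~ f n.+1, g n.+1] by [].
rewrite (fD f) commMl cE (fD g) commMr commMl -[c * e * _]mulgA.
exact: mulKg.
Qed.

(** Leibman's theorem. Both closure properties share one induction on [J], since [diffM] contains a
    commutator and [diffR] is a product of commutators; [f] and [g] themselves enter at depth [J]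
    through [poly_pred]. *)
Lemma polyMR J :
  (forall d f g, poly J d f -> poly J d g -> poly J d (fun n => f n * g n)) /\
  (forall d e f g, poly J d f -> poly J e g ->
     poly J (d + e) (fun n => [~ f n, g n])).
Proof.
elim: J => [|J [IHM IHR]].
  split=> [d f g /= [Ff _] [Fg _] |].
    by split=> // n; apply: (subM (sF d)).
  move=> d e f g /= [Ff _] [Fg _].
  by split=> // n; apply: commF.
split=> [d f g Pf Pg | ].
  have [[Ff Pf'] [Fg Pg']] := (Pf, Pg).
  split=> [n|]; first by apply: (subM (sF d)).
  apply: poly_ext (fun n => esym (diffM f g n)) _.
  apply: (IHM) => //; apply: (IHM) => //.
  apply: (@poly_dec _ _ (d.+1 + d)); first by lia.
  by apply: (IHR) => //; apply: poly_pred.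
move=> d e f g Pf Pg.
have [[Ff Pf'] [Fg Pg']] := (Pf, Pg).
split=> [n|]; first exact: commF.
apply: poly_ext (fun n => esym (diffR f g n)) _.
have {}Pf := poly_pred Pf; have {}Pg := poly_pred Pg.
have R a b k h l : (d + e).+1 <= a + b -> poly J a h -> poly J b l ->
    k = (d + e).+1 -> poly J k (fun n => [~ h n, l n]).
  by move=> le Ph Pl ->; apply: poly_dec le _; apply: (IHR).
have Pc := IHR _ _ _ _ Pf Pg; have Pu := IHR _ _ _ _ Pf Pg'.
have PE : poly J (d + e).+1 (fun n => [~ f n, diff g n] *
   ([~ [~ f n, diff g n], [~ f n, g n]] * [~ [~ f n, g n], diff g n])).
  apply: (IHM); first by rewrite -addnS.
  apply: (IHM).
    by apply: (R (d + e.+1) (d + e)) => //; lia.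
  by apply: (R (d + e) e.+1) => //; lia.
apply: (IHM) => //; apply: (IHM); first apply: (IHM).
- by apply: (R (d + e) d.+1) => //; lia.
- apply: (IHM).
    apply: (R (d + e + d.+1) (d + e).+1) => //; first by lia.
    exact: (IHR).
  by apply: (R (d + e).+1 d.+1) => //; lia.
apply: (IHM); first by apply: (R d.+1 e.+1) => //; lia.
apply: (IHM); first by apply: (R d.+1 e) => //; lia.
apply: (R (d.+1 + e) e.+1) => //; first by lia.
exact: (IHR).
Qed.

Lemma polyM J d f g :
  poly J d f -> poly J d g -> poly J d (fun n => f n * g n).
Proof. by move: d f g; case: (polyMR J). Qed.

(** By Pascal's rule the difference of [x ^+ 'C(n, i.+1)] is [x ^+ 'C(n, i)]: the degree goes up by
    one as the index goes down by one. *)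
Lemma poly_binomial J d i x :
  F (d + i) x -> poly J d (fun n => x ^+ 'C(n, i)).
Proof.
move=> Fx; have Fdx: F d x.
  by elim: i Fx => [|i IHi]; rewrite ?addn0 // addnS => /decF.
elim: J d i x Fx Fdx => [|J IHJ] d i x Fx Fdx /=.
  by split=> // n; apply: subX.
split=> [n|]; first exact: subX.
case: i Fx => [|i] Fx.
  apply: (@poly_ext _ _ (fun n => 1 ^+ 'C(n, 0))).
    by move=> n; rewrite /diff !bin0 mulVg.
  by apply: IHJ; apply: sub1.
apply: (@poly_ext _ _ (fun n => x ^+ 'C(n, i))).
  by move=> n; rewrite /diff binS expgnDr mulKg.
have Fdx1: F d.+1 x.
  rewrite -addSnnS in Fx.
  by elim: i Fx => [|i IHi]; rewrite ?addn0 // addnS => /decF.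
by apply: IHJ; rewrite // addSnnS.
Qed.

(** The value is an iterated difference: if [f] is trivial up to [i], then [diff f] is trivial below
    [i] and equals [f i.+1] at [i]. *)
Lemma poly_vanish J d i f : i <= J -> poly J d f ->
  (forall n, n < i -> f n = 1) -> F (d + i) (f i).
Proof.
elim: i J d f => [|i IHi] J d f; first by rewrite addn0 => _ /poly_val.
case: J => // J leiJ [Ff Pf] f1.
have <-: diff f i = f i.+1 by rewrite /diff f1 // invg1 mul1g.
rewrite -addSnnS; apply: IHi Pf _ => // n ltni.
by rewrite /diff !f1 ?invg1 ?mul1g // ltnW.
Qed.

(* Hall-Petrescu: subtracting Newton's interpolation terms one at a time. *)
Lemma hall_petrescu (Q : S -> Prop) n f :
  subgroup Q -> poly n 0 f -> f 0 = 1 ->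
  (forall i c, 2 <= i <= n -> F i c -> Q (c ^+ 'C(n, i))) ->
  Q ((f 1%N) ^- n * f n).
Proof.
move=> sQ Pf f0 Qc.
(* Among the arguments 0 to [n], only the last [k] may have a nontrivial value, and the induction
   removes the first of these. Indices 0 and 1 stay out: [f 0] is trivial and index 1 gives the main
   term. *)
have Q_vanish k h : 2 <= n.+1 - k -> poly n 0 h ->
    (forall m, m < n.+1 - k -> h m = 1) -> Q (h n).
  elim: k h => [|k IHk] h; first by rewrite subn0 => _ _ ->; [apply: sub1|].
  case: (ltnP n k) => [|lekn]; first by lia.
  rewrite subSS; set i := n - k => i2 Ph h1.
  have Fi : F i (h i) by exact: (poly_vanish (leq_subr k n) Ph h1).
  have Qh : Q ((h i)^-1 ^+ 'C(n, i) * h n).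
    apply: (IHk (fun m => (h i)^-1 ^+ 'C(m, i) * h m)).
    - by rewrite subSn // -/i; lia.
    - by apply: polyM => //; apply: poly_binomial; apply: (subV (sF _)).
    rewrite subSn // -/i => m; rewrite ltnS leq_eqVlt => /orP[/eqP-> | ltmi].
      by rewrite binn expg1 mulVg.
    by rewrite bin_small // expg0 mul1g h1.
  have -> : h n = h i ^+ 'C(n, i) * ((h i)^-1 ^+ 'C(n, i) * h n).
    by rewrite mulgA expVgn mulgV mul1g.
  by apply: subM Qh => //; apply: Qc; rewrite // i2 leq_subr.
case: n => [|n] in Pf Qc Q_vanish *; first by rewrite f0 invg1 mulg1; apply: sub1.
have F1 : F 1 (f 1%N) by apply: (poly_vanish _ Pf) => // -[].
rewrite -expVgn -[n.+1 in X in X * _]bin1.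
apply: (Q_vanish n (fun m => (f 1%N)^-1 ^+ 'C(m, 1) * f m)); first by lia.
  by apply: polyM => //; apply: poly_binomial; apply: (subV (sF _)).
have -> : n.+2 - n = 2 by lia.
by case=> [|[|m]] // _; rewrite ?f0 ?bin0n ?mulg1 // bin1 expg1 mulVg.
Qed.

End PolynomialSequences.

(** * Central series and exponents *)

Lemma bernoulli_expn p v : 0 < p -> 1 + (p - 1) * v <= p ^ v.
Proof.
move=> p0; elim: v => [|v IHv]; first by rewrite muln0.
rewrite expnS; apply: leq_trans (leq_mul (leqnn p) IHv).
by rewrite -{3}(subnK p0); nia.
Qed.

(** In [i * 'C(p ^ f, i) = p ^ f * 'C(p ^ f - 1, i - 1)] the factor [i] absorbs at most [p ^ v]. *)
Lemma pfactor_dvd_bin p f v i :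
  prime p -> 0 < i -> i < p ^ v.+1 -> p ^ (f - v) %| 'C(p ^ f, i).
Proof.
move=> pr_p; case: i => // i _ ltiv.
have [-> | C0] := posnP 'C(p ^ f, i.+1); first exact: dvdn0.
rewrite pfactor_dvdn // leq_subLR.
have : p ^ f %| i.+1 * 'C(p ^ f, i.+1) by rewrite -mul_bin_diag dvdn_mulr.
rewrite pfactor_dvdn ?muln_gt0 // lognM // => le_f.
apply: leq_trans le_f _; rewrite leq_add2r -ltnS.
rewrite -(ltn_exp2l _ _ (prime_gt1 pr_p)).
by apply: leq_ltn_trans ltiv; apply: dvdn_leq (pfactor_dvdnn _ _).
Qed.

Section CentralSeries.
Variable S : groupType.

Record central_series (W : nat -> S -> Prop) : Prop := CentralSeries {
  csW : forall k, subgroup (W k);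
  cs_dec : forall k w, W k.+1 w -> W k w;
  cs_comm : forall k w s, W k w -> W k.+1 [~ w, s] }.

(** For a central series, [shifts1] and [shiftsR] make these sets a filtration of [S] whose [b]-th
    term contains that of the lower central series. *)
Definition shifts (W : nat -> S -> Prop) b s :=
  forall a t, W a t -> W (a + b) [~ t, s].

Lemma Hall_Witt (x y z : S) :
  [~ [~ x, y], z] ^ y^-1 *
    ([~ [~ y^-1, z^-1], x] ^ z * [~ [~ z, x^-1], y^-1] ^ x) = 1.
Proof. by free_group. Qed.

Section Shifts.
Variables (W : nat -> S -> Prop) (cW : central_series W).
Let sW := csW cW.
Let decW := cs_dec cW.
Let commW1 := cs_comm cW.

Lemma W_le k l w : k <= l -> W l w -> W k w.
Proof.
move=> /subnK <-; elim: (l - k) => // m IHm.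
by rewrite addSn => /decW.
Qed.

Lemma WJ k w s : W k w -> W k (w ^ s).
Proof.
move=> Ww; rewrite -[w ^ s](mulKVg w) -commgEl.
by apply: (subM (sW k)) => //; apply/decW/commW1.
Qed.

Lemma WJE k w s : W k (w ^ s) -> W k w.
Proof. by move=> /(WJ s^-1); rewrite conjgK. Qed.

Lemma shifts1 s : shifts W 1 s.
Proof. by move=> a t; rewrite addn1; apply: commW1. Qed.

Lemma subgroup_shifts b : subgroup (shifts W b).
Proof.
split=> [a t _ | x y Ax Ay a t Wt | x Ax a t Wt].
- by rewrite commg1; apply: sub1.
- have -> : [~ t, x * y] = [~ t, y] * [~ t, x] ^ y by free_group.
  by apply: (subM (sW _)); [apply: Ay | apply/WJ/Ax].
apply: (@WJE _ _ x); have -> : [~ t, x^-1] ^ x = [~ t, x]^-1 by free_group.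
by apply: (subV (sW _)); apply: Ax.
Qed.

(** Three subgroups lemma, from the Hall-Witt identity for [s], [r], [t]. *)
Lemma shiftsR b c s r : shifts W b s -> shifts W c r -> shifts W (b + c) [~ s, r].
Proof.
move=> As Ar a t Wt; rewrite -invgR; apply: (subV (sW _)).
apply: (@WJE _ _ r^-1); apply: sub_invE => //.
have /mulg1_eq -> := Hall_Witt s r t.
have Vs := subV (subgroup_shifts b) As.
have Vr := subV (subgroup_shifts c) Ar.
apply: (subM (sW _)); apply: WJ.
  have -> : a + (b + c) = a + c + b by lia.
  apply: As; rewrite -invgR.
  by apply/(subV (sW _))/Vr/(subV (sW _)).
by rewrite addnA; apply/Vr/Vs.
Qed.

Hypothesis shiftsW : forall k w, W k w -> shifts W (k + 2) w.

Lemma commW i j x y : W i x -> W j y -> W (i + (j + 2)) [~ x, y].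
Proof. by move=> Wx /shiftsW; apply. Qed.

Section Hall.
Variables (Q : S -> Prop) (sQ : subgroup Q) (n : nat).

(** Commutators of elements of [W k] lie in [W (k + 2)], so the filtration can descend two steps at
    a time; truncated subtraction gives [F 0 = F 1 = W k]. *)
Lemma hallW k a b : W k a -> W k b ->
  (forall i c, 2 <= i <= n -> W (k + 2 * (i - 1)) c -> Q (c ^+ 'C(n, i))) ->
  Q ((a * b) ^- n * (a ^+ n * b ^+ n)).
Proof.
move=> Wa Wb Qc; pose F i := W (k + 2 * (i - 1)).
have sF i : subgroup (F i) by apply: sW.
have decF i x : F i.+1 x -> F i x by apply: W_le; lia.
have commF i j x y : F i x -> F j y -> F (i + j) [~ x, y].
  by move=> Fx Fy; apply: W_le (commW Fx Fy); lia.
have PX x : W k x -> poly F n 0 (fun m => x ^+ m).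
  move=> Wx; apply: (@poly_ext _ _ _ _ (fun m => x ^+ 'C(m, 1))) => [m|].
    by rewrite bin1.
  by apply: poly_binomial => //; rewrite /F addn0.
exact: (hall_petrescu sF decF commF sQ (polyM sF decF commF (PX _ Wa) (PX _ Wb))
          (mulg1 _) Qc).
Qed.

(** Here [x] comes from outside the series, so the filtration starts with [X], the subgroup
    generated by [x] and [W k]. Powers of [x] commute, hence [[X, X]] lies in [W k.+1], and the
    descent is by single steps. *)
Lemma hallX k m x u : 0 < m -> x ^+ m = 1 -> W k u ->
  (forall i c, 2 <= i <= n -> W (k + (i - 1)) c -> Q (c ^+ 'C(n, i))) ->
  Q (u ^- n * (x ^+ n * (x^-1 * u) ^+ n)).
Proof.
move=> m0 xm Wu Qc; pose X s := exists j w, W k w /\ s = x ^+ j * w.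
have WX w : W k w -> X w by exists 0%N, w; rewrite mul1g.
have xV j : x ^- j = x ^+ (j * (m - 1)).
  apply: mulg1_eq; rewrite -expgnDr -{1}[j]muln1 -mulnDr subnKC //.
  by rewrite mulnC expgnA xm expg1n.
have sX : subgroup X.
  split=> [|_ _ [i [w [Ww ->]]] [j [v [Wv ->]]] | _ [i [w [Ww ->]]]].
  - exact: WX _ (sub1 (sW k)).
  - exists (i + j)%N, (w ^ (x ^+ j) * v); split; last first.
      by rewrite expgnDr; free_group.
    by apply: (subM (sW _)) => //; apply: WJ.
  exists (i * (m - 1))%N, (w^-1 ^ (x ^- i)); split.
    by apply/WJ/(subV (sW _)).
  by rewrite -xV; free_group.
have commX y z : X y -> X z -> W k.+1 [~ y, z].
  move=> [i [w [Ww ->]]] [j [v [Wv ->]]].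
  have sk := sW k.+1.
  have Wxz : W k.+1 [~ x ^+ i, x ^+ j * v].
    have xx : [~ x ^+ i, x ^+ j] = 1 by apply/eqP/commgP/commuteX2.
    by rewrite commMr xx comm1g !mulg1 -invgR; apply/(subV sk)/commW1.
  rewrite commMl; apply: (subM sk) => //; apply: (subM sk); last exact: commW1.
  exact/decW/commW1.
pose F i := if i is i'.+2 then W (k + i'.+1) else X.
have sF i : subgroup (F i) by case: i => [|[|i]]; last exact: sW.
have decF i y : F i.+1 y -> F i y.
  by case: i => [|[|i]] //= Wy; [apply: WX|]; apply: W_le Wy; lia.
have commF i j y z : F i y -> F j z -> F (i + j)%N [~ y, z].
  have WXR l a b : W l b -> W l.+1 [~ a, b].
    by move=> Wb; rewrite -invgR; apply/(subV (sW _))/commW1.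
  have le d l a : d <= l -> W l a -> W d a by apply: W_le.
  case: i j => [|[|i]] [|[|j]] /=; rewrite ?addn0 ?addSn ?addnS ?add0n /= => Fy Fz.
  - exact/WX/decW/commX.
  - exact/WX/decW/commX.
  - by apply: le (WXR _ _ _ Fz); lia.
  - exact/WX/decW/commX.
  - by apply: le (commX _ _ Fy Fz); lia.
  - by apply: le (WXR _ _ _ Fz); lia.
  - by apply: le (commW1 _ Fy); lia.
  - by apply: le (commW1 _ Fy); lia.
  by apply: le (commW Fy Fz); lia.
have Xx : X x by exists 1%N, 1; rewrite mulg1; split=> //; apply: sub1.
have Xxu : X (x^-1 * u) by apply: (subM sX); [apply: (subV sX) | apply: WX].
have PX y : X y -> poly F n 0 (fun m => y ^+ m).
  move=> Xy; apply: (@poly_ext _ _ _ _ (fun m => y ^+ 'C(m, 1))) => [m'|].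
    by rewrite bin1.
  exact: poly_binomial.
rewrite -[u in u ^- n](mulVKg x) -{1}[x]expg1 -{1}[_ * u]expg1.
apply: (hall_petrescu sF decF commF sQ
  (polyM sF decF commF (PX _ Xx) (PX _ Xxu)) (mulg1 _)).
by move=> [|[|i]] c // le_in Wc; apply: Qc; rewrite // subn1.

Qed.

End Hall.
End Shifts.

(** * Exponents of the terms of a central series, as powers of [p] *)

Section Exponents.
Variable p : nat.
Hypotheses (p_pr : prime p) (p_odd : odd p).

Let p_gt0 : 0 < p. Proof. exact: prime_gt0. Qed.
Let p_gt2 : 2 < p. Proof. exact: odd_prime_gt2. Qed.

Definition kills f (w : S) := w ^+ (p ^ f) = 1.

Lemma kills_le f g w : f <= g -> kills f w -> kills g w.
Proof.
by rewrite /kills => /subnKC <-; rewrite expnD expgnA => ->; apply: expg1n.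
Qed.

Lemma killsX f g w : kills (f + g) w -> kills f (w ^+ (p ^ g)).
Proof. by rewrite /kills -expgnA -expnD addnC. Qed.

Lemma kills_bin f i c : 0 < i ->
  kills (f - trunc_log p i) c -> c ^+ 'C(p ^ f, i) = 1.
Proof.
move=> i0; have /andP[_ lti] := trunc_log_bounds (prime_gt1 p_pr) i0.
have /dvdnP[m ->] := pfactor_dvd_bin f p_pr i0 lti.
by rewrite /kills mulnC expgnA => ->; apply: expg1n.
Qed.

Lemma trunc_log_le i : 0 < i -> 1 + (p - 1) * trunc_log p i <= i.
Proof.
move=> i0; have /andP[lei _] := trunc_log_bounds (prime_gt1 p_pr) i0.
exact: leq_trans (bernoulli_expn _ p_gt0) lei.
Qed.

(** The depth [i - 1] of the Hall-Petrescu term of index [i] leaves room for one step and then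
    [trunc_log p i] steps of length [p - 2]. In case (i) each of the latter saves one factor [p]
    that the binomial coefficient may lack. *)
Lemma trunc_log_lt i : 2 <= i -> 1 + (p - 2) * trunc_log p i < i.
Proof.
move=> i2; have := trunc_log_le (ltnW i2); set v := trunc_log p i.
have -> : ((p - 1) * v = (p - 2) * v + v)%N.
  by rewrite -mulSnr; congr (_ * _)%N; lia.
by case: v => [|v]; [rewrite muln0 | lia].
Qed.

(** An induction principle: [W] is contained in the subgroup generated by [P]. *)
Definition generates (P W : S -> Prop) :=
  forall Q, subgroup Q -> (forall w, P w -> Q w) -> forall w, W w -> Q w.

Definition exp_dvd (W : nat -> S -> Prop) k f := forall w, W k w -> kills f w.

Section Generation.
Variables (W : nat -> S -> Prop) (cW : central_series W).
Hypothesis shiftsW : forall k w, W k w -> shifts W (k + 2) w.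

Lemma exp_le k l f g : k <= l -> f <= g -> exp_dvd W k f -> exp_dvd W l g.
Proof. by move=> lekl lefg Tk w /(W_le cW lekl) /Tk /(kills_le lefg). Qed.

(** The last hypothesis kills all correction terms in [hallW], so the elements of [W k] killed by
    [p ^ g] form a subgroup. *)
Lemma exp_gen k g P : generates P (W k) ->
  (forall w, P w -> W k w /\ kills g w) ->
  (forall i, 2 <= i -> exp_dvd W (k + 2 * (i - 1)) (g - trunc_log p i)) ->
  exp_dvd W k g.
Proof.
move=> genP Pg Tk w Ww; have sW := csW cW.
suffices : W k w /\ kills g w by case.
apply: (genP (fun w => W k w /\ kills g w)) Ww => // {w}.
split=> [|a b [Wa ka] [Wb kb]|a [Wa ka]].
- by split; [apply: sub1 | apply: expg1n].
- split; first exact: (subM (sW k)).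
  have : (a * b) ^- (p ^ g) * (a ^+ (p ^ g) * b ^+ (p ^ g)) = 1.
    apply: (hallW cW shiftsW (subgroup_trivial S) Wa Wb) => i c /andP[i2 _] Wc.
    by apply: kills_bin; [apply: ltnW | apply: Tk Wc].
  by rewrite ka kb !mulg1 => /eqP; rewrite invg_eq1 => /eqP.
by split; [apply: (subV (sW k)) | rewrite /kills expVgn ka invg1].
Qed.

End Generation.

Variables (W : nat -> S -> Prop) (cW : central_series W).
Hypothesis genW : forall k,
  generates (fun u => exists w s, W k w /\ u = [~ w, s]) (W k.+1).
(* [W 0] acts on itself through commutators, hence shifts every finer series
   by two steps. *)
Hypothesis shiftsW0 : forall B, central_series B ->
  (forall k w, B k w -> W k w) -> forall w, W 0 w -> shifts B 2 w.
Variables (e K : nat).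
Hypothesis nilW : forall w, W K w -> w = 1.
(** Modelled on w = x /\ y, where [x^-1 * w] is the inverse of the image of x under the homomorphism
    g |-> (g /\ y)^-1 g. *)
Hypothesis wedgeW : forall k, generates
  (fun w => W k w /\ exists2 x, x ^+ (p ^ e) = 1 & (x^-1 * w) ^+ (p ^ e) = 1)
  (W k).

(** Induction along [genW]: each further commutator with an element of [S] adds one step by
    [shiftsR]. *)
Lemma shiftsW B : central_series B -> (forall k w, B k w -> W k w) ->
  forall k w, W k w -> shifts B (k + 2) w.
Proof.
move=> cB BW; elim=> [|k IHk]; first exact: shiftsW0.
move=> w; apply: genW => [|_ [v [s [/IHk Av ->]]]]; first exact: subgroup_shifts.
have -> : k.+1 + 2 = k + 2 + 1 by lia.
exact: shiftsR (shifts1 cB s).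
Qed.

Lemma W_downward (P : nat -> Prop) :
  (forall k, K <= k -> P k) -> (forall k, (forall l, k < l -> P l) -> P k) ->
  forall k, P k.
Proof.
move=> PK PS k; have [m] := ubnP (K - k); elim: m k => // m IHm k ltKm.
apply: PS => l ltkl; have [leKl | ltlK] := leqP K l; first exact: PK.
by apply: IHm; lia.
Qed.

Lemma exp_nil k f : K <= k -> exp_dvd W k f.
Proof. by move=> leKk w /(W_le cW leKk) /nilW ->; apply: expg1n. Qed.

(* If [x] and [x^-1 w] have trivial [p^f]-th power then Hall's formula turns
   [x^n (x^-1 w)^n = 1] into a formula for [w^n]. *)
Lemma exp_wedge k f : e <= f ->
  (forall i, 2 <= i -> exp_dvd W (k + (i - 1)) (f - trunc_log p i)) -> exp_dvd W k f.
Proof.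
move=> le_ef Tk; have shW := shiftsW cW (fun _ _ => id).
apply: (exp_gen cW shW (@wedgeW k)) => [w [Ww [x xe xwe]] | i i2]; last first.
  by apply: (exp_le cW) (Tk i i2); lia.
split=> //; have xf := kills_le le_ef xe; have xwf := kills_le le_ef xwe.
have : w ^- (p ^ f) * (x ^+ (p ^ f) * (x^-1 * w) ^+ (p ^ f)) = 1.
  apply: (hallX cW shW (subgroup_trivial S) _ xf Ww); first by rewrite expn_gt0 p_gt0.
  move=> i c /andP[i2 _] Wc.
  by apply: kills_bin; [apply: ltnW | apply: Tk Wc].
by rewrite xf xwf !mulg1 => /eqP; rewrite invg_eq1 => /eqP.
Qed.

Lemma exp_iter d r k0 :
  (forall k f, k0 <= k -> exp_dvd W k f -> exp_dvd W (k + d) (f - r)) ->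
  forall f s, exp_dvd W k0 f -> exp_dvd W (k0 + d * s) (f - r * s).
Proof.
move=> exp_drop f s Tk; elim: s => [|s IHs]; first by rewrite !muln0 addn0 subn0.
by apply: (exp_le cW) (exp_drop _ _ _ IHs); lia.
Qed.

Definition span (P : S -> Prop) w :=
  forall Q, subgroup Q -> (forall v, P v -> Q v) -> Q w.

Lemma subgroup_span P : subgroup (span P).
Proof.
split=> [Q sQ _ | x y Px Py Q sQ PQ | x Px Q sQ PQ]; first exact: sub1.
  by apply: (subM sQ); [apply: Px | apply: Py].
by apply: (subV sQ); apply: Px.
Qed.

Lemma span_gen (P : S -> Prop) w : P w -> span P w.
Proof. by move=> Pw Q _; apply. Qed.

Lemma span_comm (P Q : S -> Prop) : subgroup Q ->
  (forall w g, P w -> P (w ^ g)) -> (forall w s, P w -> Q [~ w, s]) ->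
  forall w s, span P w -> Q [~ w, s].
Proof.
move=> sQ PJ PQ w s Pw.
(* The induction needs all conjugates of [w] and all [s], because [ab, t] = [a^b, t^b] [b, t]. *)
suffices /(_ s 1) : forall s g, Q [~ w ^ g, s] by rewrite conjg1.
apply: (Pw (fun w => forall s g, Q [~ w ^ g, s])) => [|v Pv t g].
  split=> [t g | a b Qa Qb t g | a Qa t g].
  - by rewrite conj1g comm1g; apply: sub1.
  - have -> : [~ (a * b) ^ g, t] = [~ a ^ (g * b ^ g), t ^ (b ^ g)] * [~ b ^ g, t].
      by free_group.
    exact: (subM sQ).
  have -> : [~ a^-1 ^ g, t] = [~ a ^ g, t ^ (a^-1 ^ g)]^-1 by free_group.
  exact: (subV sQ).
by apply: PQ; apply: PJ.
Qed.

(** For v = x /\ y this element is x^q /\ y, by [wedgeXl] below. *)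
Definition power_seeds q w :=
  exists x v, [/\ W 0 v, x ^+ (p ^ e) = 1 & w = x ^+ q * (x^-1 * v) ^+ q].

(** * The central series B_k spanned by powers *)

Section PowerSeries.
Variables (d q : nat) (P : nat -> S -> Prop).
Hypothesis PW : forall k w, P k w -> W k w.
Hypothesis P_dec : forall k w, P k.+1 w -> P k w.
Hypothesis PJ : forall k w g, P k w -> P k (w ^ g).
Hypothesis P_power : forall k v, W k v -> P k (v ^+ q).
Hypothesis P_bin : forall k i c,
  2 <= i <= q -> W (k + (i - 1)) c -> span (P k) (c ^+ 'C(q, i)).
Hypothesis P_comm : forall k w s,
  P k w -> (exists2 v, W k v & w = v ^+ q) \/ span (P k.+1) [~ w, s].
Hypothesis base : generates (power_seeds q) (W d).

Let B k := span (P k).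

Lemma span_sub k w : B k w -> W k w.
Proof. by apply; [apply: (csW cW) | apply: PW]. Qed.

(** For a seed u^q, [u^q, t] = u^-q (u^t)^q is [u, t]^q up to Hall-Petrescu terms. These fall under
    [P_bin] at [k.+1], since [k + 2 * (i - 1)] is at least [k.+1 + (i - 1)] for [i >= 2]. *)
Lemma span_series : central_series B.
Proof.
have sB k : subgroup (B k) by apply: subgroup_span.
split=> // [k w Bw | k w s].
  by apply: Bw => // v /P_dec; apply: span_gen.
apply: (span_comm (sB _) (@PJ k)) => v t /P_comm-/(_ t) [[u Wu ->] | //].
have -> : [~ u ^+ q, t] = u^-1 ^+ q * (u ^ t) ^+ q.
  by rewrite commgEl conjXg expVgn.
have Wut : W k (u ^ t) by apply: (WJ cW).
have WuV : W k u^-1 by apply: (subV (csW cW k)).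
rewrite -(mulKVg ((u^-1 * u ^ t) ^+ q) (_ * _)); apply: (subM (sB _)).
  by apply: span_gen; apply: P_power; rewrite -commgEl; apply: (cs_comm cW).
apply: (hallW cW (shiftsW cW (fun _ _ => id)) (sB _) WuV Wut) => i c i2q Wc.
by apply: P_bin => //; apply: (W_le cW) Wc; lia.
Qed.

(** By [hallX] a seed is v^q up to terms covered by [P_bin], which settles [k = 0]; commutators with
    [S] then lower both series together. *)
Lemma W_span k w : W (k + d) w -> B k w.
Proof.
have sB := csW span_series.
elim: k w => [|k IHk].
  apply: base => // _ [x [v [Wv xe ->]]].
  rewrite -(mulKVg (v ^+ q) (_ * _)); apply: (subM (sB 0)).
    by apply: span_gen; apply: P_power.
  apply: (hallX cW (shiftsW cW (fun _ _ => id)) (sB 0) _ xe Wv).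
    by rewrite expn_gt0 p_gt0.
  exact: P_bin.
by apply: genW => // _ [w [s [/IHk Bw ->]]]; apply: (cs_comm span_series).
Qed.

Lemma exp_span k g : (forall w, P k w -> kills g w) ->
  (forall i, 2 <= i -> exp_dvd B (k + 2 * (i - 1)) (g - trunc_log p i)) ->
  exp_dvd B k g.
Proof.
move=> Pg; have shB k' w : B k' w -> shifts B (k' + 2) w.
  by move=> /span_sub; apply: shiftsW span_series span_sub _ _.
apply: (exp_gen span_series shB (P := P k)) => [Q sQ PQ w | w Pw]; first exact.
by split; [apply: span_gen | apply: Pg].
Qed.
End PowerSeries.

(** * Case (i): the exponent drops by p every p - 2 steps *)

Section CaseOne.
Hypothesis base : generates (power_seeds p) (W (p - 2)).

Let P k w := (exists2 v, W k v & w = v ^+ p) \/ W (k + (p - 1)) w.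

Let PW k w : P k w -> W k w.
Proof.
case=> [[v Wv ->] | ]; first exact: subX (csW cW k) Wv.
by apply: (W_le cW); lia.
Qed.

Let P_dec k w : P k.+1 w -> P k w.
Proof.
case=> [[v Wv ->] | Ww]; [left | right]; last by apply: (W_le cW) Ww; lia.
by exists v => //; apply: (cs_dec cW).
Qed.

Let PJ k w g : P k w -> P k (w ^ g).
Proof.
case=> [[v Wv ->] | Ww]; [left | right]; last exact: WJ.
by exists (v ^ g); rewrite ?conjXg //; apply: WJ.
Qed.

Let P_power k v : W k v -> P k (v ^+ p).
Proof. by left; exists v. Qed.

(** For [i < p] the coefficient is divisible by [p]; the term [i = p], with coefficient 1, accounts
    for [W (k + (p - 1))] in [P]. *)
Let P_bin k i c :
  2 <= i <= p -> W (k + (i - 1)) c -> span (P k) (c ^+ 'C(p, i)).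
Proof.
move=> /andP[i2 lei] Wc; apply: span_gen; have [ltip | gep] := ltnP i p.
  have /dvdnP[m ->] := prime_dvd_bin (k := i) p_pr ltac:(lia).
  rewrite expgnA; apply: P_power; apply: (subX _ (csW cW k)).
  by apply: (W_le cW) Wc; lia.
have -> : i = p by lia.
by rewrite binn expg1; right; apply: (W_le cW) Wc; lia.
Qed.

Let P_comm k w s :
  P k w -> (exists2 v, W k v & w = v ^+ p) \/ span (P k.+1) [~ w, s].
Proof.
case=> [|Ww]; [by left | right; apply: span_gen; right].
exact: (cs_comm cW).
Qed.

Let B k := span (P k).
Let cB : central_series B := span_series P_dec PJ P_power P_bin P_comm.
Let WB := W_span P_dec PJ P_power P_bin P_comm base.

Lemma exp_span1 k f : exp_dvd W k f -> exp_dvd B k (f - 1).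
Proof.
move: k f; apply: W_downward => [k leKk f _ | k IHk f Tk].
  by move=> w /(span_sub PW); apply: exp_nil.
(* For [l > k], [W (l + (p - 2))] lies in [B l], to which the induction hypothesis applies. *)
have Tit s : exp_dvd W (k.+1 + (p - 2) * s) (f - 1 * s).
  apply: exp_iter; last by apply: (exp_le cW) Tk.
  by move=> l f' le_l Tl w /WB; apply: IHk Tl _.
apply: (exp_span PW P_dec PJ P_power P_bin P_comm) => [w [[v Wv ->] | Ww] | i i2].
- case: f Tk {Tit} => [|f] Tk; last first.
    by rewrite subn1; apply: (@killsX _ 1); rewrite addn1; apply: Tk.
  by apply: (killsX (g := 1)); apply: kills_le (Tk _ Wv).
(* As p - 1 = 1 + (p - 2), the seeds from [W (k + (p - 1))] already lie in [B k.+1]. *)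
- apply: (IHk k.+1) => //; first by apply: (exp_le cW) Tk.
  by apply: WB; apply: (W_le cW) Ww; lia.
have := trunc_log_lt i2; set v := trunc_log p i => lev.
by apply: (exp_le cB) (IHk _ _ _ (Tit v)); rewrite ?addSn ?ltnS ?leq_addr //; lia.
Qed.

(** By [trunc_log_lt], the term of index [i] is reached from [W k.+1] by [trunc_log p i] drops. *)
Lemma exp_case1 k : exp_dvd W k e.
Proof.
move: k; apply: W_downward => [k leKk | k IHk]; first exact: exp_nil.
apply: exp_wedge => // i i2.
have := trunc_log_lt i2; set v := trunc_log p i => lev.
have Tit : exp_dvd W (k.+1 + (p - 2) * v) (e - 1 * v).
  apply: exp_iter => [l f _ Tl w /WB|]; last exact: IHk.
  exact: exp_span1.
by apply: (exp_le cW) Tit; lia.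
Qed.
End CaseOne.

(** * Case (ii): the exponent drops by p^2 every p - 1 steps *)

Section CaseTwo.
Hypothesis base : generates (power_seeds (p ^ 2)) (W (p - 1)).

Let P k w := [\/ exists2 v, W k v & w = v ^+ (p ^ 2),
  exists2 v, W (k + (p - 1)) v & w = v ^+ p | W (k + p) w].

Let PW k w : P k w -> W k w.
Proof.
case=> [[v Wv ->] | [v Wv ->] | ].
- exact: subX (csW cW k) Wv.
- by apply: (subX _ (csW cW k)); apply: (W_le cW) Wv; lia.
by apply: (W_le cW); lia.
Qed.

Let P_dec k w : P k.+1 w -> P k w.
Proof.
case=> [[v Wv ->] | [v Wv ->] | Ww].
- by apply: Or31; exists v => //; apply: (cs_dec cW).
- by apply: Or32; exists v => //; apply: (cs_dec cW).
by apply: Or33; apply: (cs_dec cW).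
Qed.

Let PJ k w g : P k w -> P k (w ^ g).
Proof.
case=> [[v Wv ->] | [v Wv ->] | Ww].
- by apply: Or31; exists (v ^ g); rewrite ?conjXg //; apply: WJ.
- by apply: Or32; exists (v ^ g); rewrite ?conjXg //; apply: WJ.
by apply: Or33; apply: WJ.
Qed.

Let P_power k v : W k v -> P k (v ^+ (p ^ 2)).
Proof. by move=> Wv; apply: Or31; exists v. Qed.

(** The three kinds of seeds match three ranges of [i]: the coefficient is divisible by p^2 below p,
    by p from p to p^2 - 1, and is 1 at p^2, where the depth p^2 - 1 is at least p. *)
Let P_bin k i c :
  2 <= i <= p ^ 2 -> W (k + (i - 1)) c -> span (P k) (c ^+ 'C(p ^ 2, i)).
Proof.
move=> /andP[i2 lei] Wc; apply: span_gen; have [ltip | lepi] := ltnP i p.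
  have /dvdnP[m ->] : p ^ 2 %| 'C(p ^ 2, i).
    by apply: (pfactor_dvd_bin 2 (v := 0) p_pr); rewrite ?expn1 // ltnW.
  rewrite expgnA; apply: P_power; apply: (subX _ (csW cW k)).
  by apply: (W_le cW) Wc; lia.
have [ltip2 | gep2] := ltnP i (p ^ 2).
  have /dvdnP[m ->] : p %| 'C(p ^ 2, i).
    by apply: (pfactor_dvd_bin 2 (v := 1) p_pr); rewrite // ltnW.
  rewrite expgnA; apply: Or32; exists (c ^+ m) => //.
  by apply: (subX _ (csW cW _)); apply: (W_le cW) Wc; lia.
have -> : i = (p ^ 2)%N by apply/eqP; rewrite eqn_leq lei.
rewrite binn expg1; apply: Or33; apply: (W_le cW) Wc.
have : 2 * p <= p * p by rewrite leq_mul2r ltnW ?orbT.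
by rewrite -mulnn in gep2; lia.
Qed.

(** For the middle seeds, [v^p, s] is [v, s]^p up to terms of depth at least k + (p - 1) + 2 = (k +
    1) + p, which are seeds of the third kind. *)
Let P_comm k w s :
  P k w -> (exists2 v, W k v & w = v ^+ (p ^ 2)) \/ span (P k.+1) [~ w, s].
Proof.
case=> [|[v Wv ->] | Ww]; [by left | right | right]; last first.
  by apply: span_gen; apply: Or33; apply: (cs_comm cW).
have -> : [~ v ^+ p, s] = v^-1 ^+ p * (v ^ s) ^+ p.
  by rewrite commgEl conjXg expVgn.
have sB : subgroup (span (P k.+1)) by apply: subgroup_span.
have Wvs : W (k + (p - 1)) (v ^ s) by apply: (WJ cW).
have WvV : W (k + (p - 1)) v^-1 by apply: (subV (csW cW _)).
rewrite -(mulKVg ((v^-1 * v ^ s) ^+ p) (_ * _)); apply: (subM sB).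
  apply: span_gen; apply: Or32; exists [~ v, s] => //.
  exact: (cs_comm cW).
apply: (hallW cW (shiftsW cW (fun _ _ => id)) sB WvV Wvs) => i c i2q Wc.
apply: span_gen; apply: Or33; apply: (subX _ (csW cW _)).
by apply: (W_le cW) Wc; lia.
Qed.

Let B k := span (P k).
Let cB : central_series B := span_series P_dec PJ P_power P_bin P_comm.
Let WB := W_span P_dec PJ P_power P_bin P_comm base.

Lemma exp_span2 k f : exp_dvd W k f -> exp_dvd B k (f - 2).
Proof.
move: k f; apply: W_downward => [k leKk f _ | k IHk f Tk].
  by move=> w /(span_sub PW); apply: exp_nil.
have Tit s : exp_dvd W (k.+1 + (p - 1) * s) (f - 2 * s).
  apply: exp_iter; last by apply: (exp_le cW) Tk.
  by move=> l f' le_l Tl w /WB; apply: IHk Tl _.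
(* A middle seed v^p has v in [B k] itself, so the exponent of [B k] is improved by one factor p at
   a time, starting from that of [W k]. *)
suffices step g : f - 2 <= g -> exp_dvd B k g.+1 -> exp_dvd B k g.
  apply: (step) => //; apply: (step); first exact: leqnSn.
  by move=> w /(span_sub PW)/Tk; apply: kills_le; lia.
move=> le_fg TB.
apply: (exp_span PW P_dec PJ P_power P_bin P_comm).
  move=> w [[v Wv ->] | [v Wv ->] | Ww].
  - by apply: (@killsX _ 2); apply: kills_le (Tk _ Wv); lia.
  - by apply: (@killsX _ 1); rewrite addn1; apply: TB _ (WB Wv).
  apply: (kills_le le_fg); apply: (IHk k.+1) => //.
    by apply: (exp_le cW) Tk.
  by apply: WB; apply: (W_le cW) Ww; lia.
move=> i i2; have := trunc_log_le (ltnW i2); set v := trunc_log p i => lev.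
by apply: (exp_le cB) (IHk _ _ _ (Tit v)); rewrite ?addSn ?ltnS ?leq_addr //; lia.
Qed.

(** Let v be [trunc_log p i]. From [W k.+1] there is room for v - 1 drops by p^2, which suffices for
    v >= 2 but is one factor p short for v = 1. So [p ^ e.+1] is reached first; then a drop from
    [W k] itself settles v = 1. *)
Lemma exp_case2 k : exp_dvd W k e.
Proof.
move: k; apply: W_downward => [k leKk | k IHk]; first exact: exp_nil.
have exp_drop l f : exp_dvd W l f -> exp_dvd W (l + (p - 1)) (f - 2).
  by move=> Tl w /WB; apply: exp_span2.
have Tit i : 2 <= i -> 0 < trunc_log p i ->
    exp_dvd W (k + (i - 1)) (e - 2 * (trunc_log p i - 1)).
  move=> i2; have := trunc_log_le (ltnW i2).
  case: (trunc_log p i) => // v lev _; rewrite mulnS in lev; rewrite subn1 /=.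
  have Tv : exp_dvd W (k.+1 + (p - 1) * v) (e - 2 * v).
    by apply: exp_iter => [l f _|]; [apply: exp_drop | apply: IHk].
  by apply: (exp_le cW) Tv; lia.
have Tk1 i : 2 <= i -> exp_dvd W (k + (i - 1)) e.
  by move=> i2; apply: (exp_le cW) (IHk k.+1 (ltnSn k)); lia.
have Te1 : exp_dvd W k e.+1.
  apply: exp_wedge => // i i2; have [v0 | v_gt0] := posnP (trunc_log p i).
    by apply: (exp_le cW) (Tk1 i i2); lia.
  by apply: (exp_le cW) (Tit i i2 v_gt0); lia.
apply: exp_wedge => // i i2; have lev := trunc_log_le (ltnW i2).
have [v0 | v_gt0] := posnP (trunc_log p i).
  by apply: (exp_le cW) (Tk1 i i2); lia.
have [v1 | v_neq1] := eqVneq (trunc_log p i) 1%N.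
  by apply: (exp_le cW) (exp_drop _ _ Te1); rewrite v1 in lev *; lia.
by apply: (exp_le cW) (Tit i i2 v_gt0); lia.
Qed.
End CaseTwo.
End Exponents.
End CentralSeries.

(** * The exterior square in its semidirect product with the group *)

Section WedgeTheory.
Variables (gT : finGroupType) (G : {group gT}).
Local Notation H := (subg_of G).
(** An abstract form of the semidirect product: [i] embeds G, [t x y] is x /\ y, and [d] is the
    retraction onto G extending the commutator map. *)
Variables (S : groupType) (i : H -> S) (t : H -> H -> S) (d : S -> H).
Hypothesis iM : {morph i : x y / x * y}.
Hypothesis dM : {morph d : x y / x * y}.
Hypothesis di : cancel i d.
Hypothesis dt : forall x y, d (t x y) = x * y * x^-1 * y^-1.
Hypothesis tJ : forall x y g, t x y ^ i g = t (x ^ g) (y ^ g).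
Hypothesis tMl : forall x x' y, t (x * x') y = t x' y ^ (i x)^-1 * t x y.
Hypothesis tMr : forall x y y', t x (y * y') = t x y * t x y' ^ (i y)^-1.
Hypothesis txx : forall x, t x x = 1.
Hypothesis genS : forall Q, subgroup Q -> (forall x y, Q (t x y)) ->
  (forall g, Q (i g)) -> forall s, Q s.

Lemma emb1 : i 1 = 1.
Proof. by apply: (mulgI (i 1)); rewrite -iM !mulg1. Qed.

Lemma embV x : i x^-1 = (i x)^-1.
Proof. by apply: esym; apply: mulg1_eq; rewrite -iM mulgV emb1. Qed.

Lemma bd1 : d 1 = 1.
Proof. by apply: (mulgI (d 1)); rewrite -dM !mulg1. Qed.

Lemma bdV x : d x^-1 = (d x)^-1.
Proof. by apply: esym; apply: mulg1_eq; rewrite -dM mulgV bd1. Qed.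

Lemma wedgeJV x y g : t x y ^ (i g)^-1 = t (x ^ g^-1) (y ^ g^-1).
Proof. by rewrite -embV tJ. Qed.

Lemma wedge1x y : t 1 y = 1.
Proof.
by apply: (mulgI (t 1 y)); have := tMl 1 1 y; rewrite emb1 invg1 conjg1 !mulg1.
Qed.

Lemma wedgex1 x : t x 1 = 1.
Proof.
by apply: (mulgI (t x 1)); have := tMr x 1 1; rewrite emb1 invg1 conjg1 !mulg1.
Qed.

(** Expand (x y) /\ (x y) = 1. *)
Lemma wedge_sym x y : (t y x)^-1 = t x y.
Proof.
apply: mulg1_eq; apply: (@conjg_inj S (i x)^-1); rewrite conj1g.
by have := txx (x * y); rewrite tMl !tMr !txx conj1g mulg1 mul1g conjMg.
Qed.

Definition wedge_seeds k (s : S) :=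
  exists x y, val x \in 'L_k.+1(G) /\ s = t x y.

Definition wedge_lcn k := span (wedge_seeds k).

Lemma subgroup_wedge_lcn k : subgroup (wedge_lcn k). Proof. exact: subgroup_span. Qed.

Lemma wedge_in_lcn0 x y : wedge_lcn 0 (t x y).
Proof. by apply: span_gen; exists x, y; split=> //; apply: valP. Qed.

(* Expanding [(x x') /\ (y y')] in two ways shows that [x /\ y] acts on the
   exterior square as the commutator of [x] and [y] does. *)
Lemma wedge_conj_wedge x y x' y' : t x' y' ^ t x y = t x' y' ^ i (x * y * x^-1 * y^-1).
Proof.
have E u v : t u v ^ ((i y)^-1 * (i x)^-1) * t x y =
             t x y * t u v ^ ((i x)^-1 * (i y)^-1).
  have : t (x * u) (y * v) = t u y ^ (i x)^-1 *
      ((t u v ^ (i y)^-1) ^ (i x)^-1 * (t x y * t x v ^ (i y)^-1)).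
    by rewrite tMl !tMr conjMg; apply/esym/mulgA.
  have -> : t (x * u) (y * v) = t u y ^ (i x)^-1 *
      (t x y * ((t u v ^ (i x)^-1) ^ (i y)^-1 * t x v ^ (i y)^-1)).
    by rewrite tMr !tMl conjMg; apply/esym/mulgA.
  by move/mulgI; rewrite [LHS]mulgA [RHS]mulgA => /mulIg E; rewrite !conjgM E.
have := E (x' ^ (x * y)) (y' ^ (x * y)).
rewrite -tJ iM -!conjgM.
have -> : i x * i y * ((i y)^-1 * (i x)^-1) = 1 by free_group.
by rewrite conjg1 [LHS]conjgC => /mulgI ->; rewrite !iM !embV !mulgA.
Qed.

Lemma wedge_lcn_conj_i k w g : wedge_lcn k w -> wedge_lcn k (w ^ i g).
Proof.
move=> Ww; have sk := subgroup_wedge_lcn k.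
apply: (Ww (fun w => wedge_lcn k (w ^ i g))) => [|_ [x [y [Lx ->]]]].
  split=> [|a b Wa Wb|a Wa]; rewrite ?conj1g ?conjMg ?conjVg.
  - exact: (sub1 sk).
  - exact: (subM sk).
  exact: (subV sk).
apply: span_gen; exists (x ^ g), (y ^ g); split; last exact: tJ.
have -> : val (x ^ g) = val x ^ val g by [].
by rewrite memJ_norm // (subsetP (normal_norm (lcn_normal _ _))) // (valP g).
Qed.

(** Peiffer identity of the crossed module, checked on the generators of [S]. *)
Lemma wedge_lcn0_conj w s : wedge_lcn 0 w -> w ^ s = w ^ i (d s).
Proof.
move: s w; apply: genS => [|x y w Ww|g w _]; last by rewrite di.
  split=> [w _ | x y Ax Ay w Ww | x Ax w Ww]; first by rewrite bd1 emb1.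
    rewrite conjgM Ax // Ay; last exact: wedge_lcn_conj_i.
    by rewrite dM iM conjgM.
  rewrite bdV; apply: (@conjg_inj S x); rewrite conjgKV Ax; last exact: wedge_lcn_conj_i.
  by rewrite embV conjgKV.
rewrite dt; apply: (Ww (fun w => w ^ t x y = w ^ i (x * y * x^-1 * y^-1))).
  split=> [|a b Ea Eb|a Ea]; rewrite ?conj1g ?conjMg ?conjVg //.
    by rewrite Ea Eb.
  by rewrite Ea.
by move=> _ [x' [y' [_ ->]]]; apply: wedge_conj_wedge.
Qed.

Lemma wedge_lcn_sub0 k w : wedge_lcn k w -> wedge_lcn 0 w.
Proof.
apply=> [|_ [x [y [_ ->]]]]; [exact: subgroup_wedge_lcn | exact: wedge_in_lcn0].
Qed.

Lemma wedge_lcn_conj k w s : wedge_lcn k w -> wedge_lcn k (w ^ s).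
Proof.
move=> Ww; rewrite wedge_lcn0_conj; first exact: wedge_lcn_conj_i.
exact: wedge_lcn_sub0 Ww.
Qed.

(** This turns wedges with elements of [G, G] into commutators in [S]. The induction on [w] carries
    membership along for the Peiffer identity. *)
Lemma wedge_bd g w : wedge_lcn 0 w -> t g (d w) = w ^ (i g)^-1 * w^-1.
Proof.
have txV x y : t x y^-1 = (t x y ^ i y)^-1.
  apply: invg_inj; rewrite invgK; apply: mulg1_eq.
  by have := tMr x y^-1 y; rewrite mulVg wedgex1 embV invgK.
move=> Ww.
suffices : wedge_lcn 0 w /\ t g (d w) = w ^ (i g)^-1 * w^-1 by case.
apply: (Ww (fun w => wedge_lcn 0 w /\ t g (d w) = w ^ (i g)^-1 * w^-1)).
  have s0 := subgroup_wedge_lcn 0; split=> [|a b [Wa Ea] [Wb Eb]|a [Wa Ea]].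
  - by split; [apply: (sub1 s0) | rewrite bd1 wedgex1 conj1g invg1 mulg1].
  - split; first exact: (subM s0).
    rewrite dM tMr -embV -bdV -(wedge_lcn0_conj _ (wedge_in_lcn0 _ _)) Ea Eb.
    by free_group.
  split; first exact: (subV s0).
  by rewrite bdV txV -(wedge_lcn0_conj _ (wedge_in_lcn0 _ _)) Ea; free_group.
move=> _ [x [y [_ ->]]]; split; first exact: wedge_in_lcn0.
(* Expand (g x) /\ y both as written and through g x = x g^x. *)
have Exy : t g (y ^ x^-1) = t x y ^ (i g)^-1 * (t g y * (t x y)^-1).
  have E : t (g * x) y = t g (y ^ x^-1) * t x y.
    by rewrite (conjgC g x) tMl wedgeJV conjgK.
  rewrite tMl in E.
  by rewrite mulgA E mulgK.
rewrite dt -mulgA -(mulgA x); have -> : x * (y * (x^-1 * y^-1)) = y ^ x^-1 * y^-1.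
  by free_group.
rewrite tMr Exy txV conjVg -(embV (y ^ x^-1)) -conjgM -iM.
have -> : y * (y ^ x^-1)^-1 = d (t x y)^-1 by rewrite bdV dt; free_group.
by rewrite -(wedge_lcn0_conj _ (wedge_in_lcn0 _ _)); free_group.
Qed.

(** In a finite group the truth set of [D], closed under products, is a subgroup. *)
Lemma subg_gen_ind (A : {set gT}) (D : H -> Prop) : A \subset G -> D 1 ->
  (forall x y, D x -> D y -> D (x * y)) ->
  (forall x, val x \in A -> D x) -> forall x, val x \in <<A>> -> D x.
Proof.
move=> sAG D1 DM DA x.
have gD : group_set [set z in G | `[< D (subg G z) >]].
  apply/group_setP; split=> [|y z]; rewrite !inE ?group1.
    by apply/asboolP; rewrite /= morph1.
  move=> /andP[Gy /asboolP Dy] /andP[Gz /asboolP Dz]; rewrite groupM //=.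
  by apply/asboolP; rewrite morphM //; apply: DM.
have : <<A>> \subset Group gD.
  rewrite gen_subG; apply/subsetP=> z Az; have Gz := subsetP sAG z Az.
  by rewrite inE Gz; apply/asboolP/DA; rewrite subgK.
by move=> /subsetP sAD /sAD; rewrite inE sgvalK => /andP[_ /asboolP].
Qed.

Lemma wedge_lcn_val k w : wedge_lcn k w -> val (d w) \in 'L_k.+2(G).
Proof.
move=> Ww; apply: (Ww (fun w => val (d w) \in 'L_k.+2(G))).
  split=> [|a b La Lb|a La]; first by rewrite bd1 group1.
    by rewrite dM groupM.
  by rewrite bdV groupV.
move=> _ [x [y [Lx ->]]]; rewrite dt.
have -> : val (x * y * x^-1 * y^-1) = [~ (val x)^-1, (val y)^-1].
  by rewrite commgEl conjgE !invgK !mulgA.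
by rewrite lcnSn; apply: mem_commg; rewrite groupV //; apply: valP.
Qed.

Lemma wedge_lcn_val_onto k x : val x \in 'L_k.+2(G) -> exists2 w, wedge_lcn k w & d w = x.
Proof.
have sk := subgroup_wedge_lcn k.
move: x; apply: (@subg_gen_ind (commg_set 'L_k.+1(G) G)).
- apply: subset_trans (der1_subG _); apply: subset_trans (subset_gen _) _.
  by apply: commSg; exact: lcn_sub.
- by exists 1; [apply: (sub1 sk) | apply: bd1].
- move=> _ _ [a Wa <-] [b Wb <-]; exists (a * b); last exact: dM.
  exact: (subM sk).
move=> x /imset2P[a b La Gb xE].
have Ga : a \in G := subsetP (lcn_sub _ _) a La.
(* The inverses reconcile x y x^-1 y^-1, the value of [t x y], with the library commutator x^-1 y^-1
   x y. *)
exists (t (subg G a)^-1 (subg G b)^-1).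
  by apply: span_gen; exists (subg G a)^-1, (subg G b)^-1; rewrite /= subgK // groupV.
by apply: val_inj; rewrite dt /= !subgK // xE !invgK commgEl conjgE !mulgA.
Qed.

(** By [wedge_bd], [[~ w, s]] is conjugate to g /\ d(w), and d(w) lies in gamma_(k+2)(G). *)
Lemma wedge_lcn_comm k w s : wedge_lcn k w -> wedge_lcn k.+1 [~ w, s].
Proof.
move=> Ww; have W0w := wedge_lcn_sub0 Ww; set g := (d s)^-1.
have -> : [~ w, s] = (t (d w) g)^-1 ^ w.
  rewrite wedge_sym wedge_bd // -embV /g invgK -(wedge_lcn0_conj s W0w) commgEl.
  by rewrite [RHS]conjgE mulgVK.
apply: wedge_lcn_conj; apply: (subV (subgroup_wedge_lcn _)); apply: span_gen.
by exists (d w), g; split=> //; apply: wedge_lcn_val.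
Qed.

Lemma wedge_lcn_gen k :
  generates (fun u => exists w s, wedge_lcn k w /\ u = [~ w, s]) (wedge_lcn k.+1).
Proof.
move=> Q sQ PQ w; apply=> // _ [x [y [/wedge_lcn_val_onto[v Wv <-] ->]]].
rewrite -wedge_sym (wedge_bd _ (wedge_lcn_sub0 Wv)); apply: PQ; exists v^-1, (i y)^-1.
by split; [apply: (subV (subgroup_wedge_lcn k)) | free_group].
Qed.

Lemma wedge_lcn_series : central_series wedge_lcn.
Proof.
split=> [|k w|]; [exact: subgroup_wedge_lcn | | exact: wedge_lcn_comm].
apply=> [|_ [x [y [Lx ->]]]]; first exact: subgroup_wedge_lcn.
by apply: span_gen; exists x, y; split=> //; apply: (subsetP (lcn_subS _ _)).
Qed.

(** By the Peiffer identity x /\ y acts as a commutator of two elements of [S], each of which shifts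
    by one. *)
Lemma wedge_lcn_shifts B : central_series B -> (forall k w, B k w -> wedge_lcn k w) ->
  forall w, wedge_lcn 0 w -> shifts B 2 w.
Proof.
move=> cB BW w; apply=> [|_ [x [y [_ ->]]]]; first exact: subgroup_shifts.
move=> k v Bv; have W0v := wedge_lcn_sub0 (BW _ _ Bv).
rewrite commgEl (wedge_lcn0_conj _ W0v) -commgEl dt.
have -> : i (x * y * x^-1 * y^-1) = [~ i x^-1, i y^-1].
  by rewrite !iM !embV; free_group.
exact: (shiftsR cB (shifts1 cB _) (shifts1 cB _) Bv).
Qed.

Lemma wedge_lcn_nil n : 'L_n.+1(G) = 1 -> forall w, wedge_lcn n w -> w = 1.
Proof.
move=> L1 w Ww; apply: (Ww (fun w => w = 1)) => [|_ [x [y [Lx ->]]]].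
  exact: subgroup_trivial.
rewrite L1 in Lx; have -> : x = 1 by apply: val_inj; apply/set1P.
exact: wedge1x.
Qed.

Lemma wedgeXl n x y : t (x ^+ n) y = i x ^+ n * ((i x)^-1 * t x y) ^+ n.
Proof.
elim: n => [|n IHn]; first by rewrite !expg0 wedge1x mulg1.
rewrite expgS tMl IHn (expgS (i x)) (expgSr (_ * _)) conjgE invgK.
by rewrite !mulgA.
Qed.

Lemma embX x n : i (x ^+ n) = i x ^+ n.
Proof. by elim: n => [|n IHn]; rewrite ?emb1 // !expgS iM IHn. Qed.

Lemma wedge_lcn_generators N k : (forall x : H, x ^+ N = 1) -> generates
  (fun w => wedge_lcn k w /\ exists2 x, x ^+ N = 1 & (x^-1 * w) ^+ N = 1) (wedge_lcn k).
Proof.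
move=> HN Q sQ PQ w; apply=> // _ [x [y [Lx ->]]].
apply: PQ; split; first by apply: span_gen; exists x, y.
have ixN : i x ^+ N = 1 by rewrite -embX HN emb1.
by exists (i x) => //; have := wedgeXl N x y; rewrite HN wedge1x ixN mul1g.
Qed.

Lemma wedge_lcn_seeds p e q k : (forall x : H, x ^+ (p ^ e) = 1) ->
  'L_k.+1(G) \subset powsub G q -> generates (power_seeds p wedge_lcn e q) (wedge_lcn k).
Proof.
move=> HN Lq Q sQ PQ.
(* Conjugates are included because splitting (x x') /\ y conjugates one of the factors. *)
pose D x := forall y g, Q (t (x ^ g) y).
have DL x : val x \in <<[set z ^+ q | z in G]>> -> D x.
  move: x; apply: subg_gen_ind.
  - by apply/subsetP=> _ /imsetP[z Gz ->]; apply: groupX.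
  - by move=> y g; rewrite conj1g wedge1x; apply: (sub1 sQ).
  - move=> x x' Dx Dx' y g; rewrite conjMg tMl; apply: (subM sQ) => //.
    by rewrite wedgeJV -conjgM.
  move=> x /imsetP[z Gz xE] y g.
  have -> : x = subg G z ^+ q by apply: val_inj; rewrite /= xE -morphX ?subgK ?groupX.
  rewrite conjXg wedgeXl; apply: PQ; exists (i (subg G z ^ g)), (t (subg G z ^ g) y).
  by split=> //; [apply: wedge_in_lcn0 | rewrite -embX HN emb1].
move=> w; apply=> // _ [x [y [Lx ->]]].
by rewrite -[x]conjg1; apply: DL; apply: (subsetP Lq).
Qed.

End WedgeTheory.

(** * Construction of the semidirect product *)

Section Words.
Variables (gT : finGroupType) (G : {group gT}).
Local Notation H := (subg_of G).
Implicit Types (u v w : seq (letter gT)) (g h : gT).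

Lemma we_cat u u' v v' : wedge_eq G u u' -> wedge_eq G v v' ->
  wedge_eq G (u ++ v) (u' ++ v').
Proof.
move=> uu' vv'; apply: (@we_trans _ _ _ (u' ++ v)).
  exact: (@we_ctx _ _ [::] u u' v).
by have := we_ctx u' [::] vv'; rewrite !cats0.
Qed.

Definition letter_conj g (l : letter gT) : letter gT :=
  (lconj g l.1.1, lconj g l.1.2, l.2).

Lemma lconjE (h : finGroupType) (x y : h) : lconj x y = y ^ x^-1.
Proof. by rewrite conjgE invgK mulgA. Qed.

Lemma lconj_in g h : g \in G -> h \in G -> lconj g h \in G.
Proof. by move=> Gg Gh; rewrite lconjE groupJ ?groupV. Qed.

Lemma we_conj g u v : g \in G -> wedge_eq G u v ->
  wedge_eq G (map (letter_conj g) u) (map (letter_conj g) v).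
Proof.
move=> Gg; have gG := lconj_in Gg.
have lJ x y : lconj g (lconj x y) = lconj (lconj g x) (lconj g y).
  by rewrite !lconjE; free_group.
have lM x y : lconj g (x * y) = lconj g x * lconj g y.
  by rewrite !lconjE conjMg.
elim=> {u v} [w | u v _ | u v w _ IHu _ IHv | a u v b _ IH | x y b Gx Gy
  | x x' y Gx Gx' Gy | x y y' Gx Gy Gy' | x Gx].
- exact: we_refl.
- exact: we_sym.
- exact: we_trans IHu IHv.
- by rewrite !map_cat; apply: we_ctx.
- by apply: we_cancel; apply: gG.
- by rewrite /= /letter_conj /= lM !lJ; apply: we_left; apply: gG.
- by rewrite /= /letter_conj /= lM !lJ; apply: we_right; apply: gG.
by apply: we_diag; apply: gG.
Qed.

Lemma word_val_cat u v : word_val (u ++ v) = word_val u * word_val v.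
Proof. by elim: u => [|l u IHu] /=; rewrite ?mul1g // IHu mulgA. Qed.

Lemma word_val_eq u v : wedge_eq G u v -> word_val u = word_val v.
Proof.
elim=> {u v} // [u v w _ -> _ -> // | a u v b _ IH | x y b _ _
  | x x' y _ _ _ | x y y' _ _ _ | x _]; rewrite /word_val /letter_val /=.
- by rewrite -![foldr _ _ _]/(word_val _) !word_val_cat IH.
- by case: b => /=; free_group.
- by rewrite /lconj; free_group.
- by rewrite /lconj; free_group.
by free_group.
Qed.

End Words.

Section WedgeGroup.
Variables (gT : finGroupType) (G : {group gT}).
Local Notation H := (subg_of G).
Local Notation word := (seq (letter H)).
Implicit Types (u v w : word) (g h : H).

(** Words over [subg_of G] have all their letters in G, so the relations apply to them without side
    conditions. *)
Definition word_emb u : seq (letter gT) :=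
  [seq (val l.1.1, val l.1.2, l.2) | l <- u].

Definition weq u v := wedge_eq G (word_emb u) (word_emb v).

Definition wconj g u := map (letter_conj g) u.

Definition winv u : word := rev [seq (l.1, ~~ l.2) | l <- u].

Lemma weq_cat u u' v v' : weq u u' -> weq v v' -> weq (u ++ v) (u' ++ v').
Proof. by rewrite /weq /word_emb !map_cat; apply: we_cat. Qed.

Lemma weq_conj g u v : weq u v -> weq (wconj g u) (wconj g v).
Proof.
have E w : word_emb (wconj g w) = map (letter_conj (val g)) (word_emb w).
  by rewrite /word_emb /wconj -!map_comp.
by rewrite /weq !E; apply: we_conj; apply: valP.
Qed.

Lemma weq_mulV u : weq (u ++ winv u) [::].
Proof.
elim: u => [|[[x y] b] u IHu]; first exact: we_refl.
rewrite /winv /= rev_cons -cats1 -/(winv u) catA.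
apply: (@we_trans _ _ _ (word_emb ([:: (x, y, b)] ++ [:: (x, y, ~~ b)]))).
  apply: (@weq_cat ([:: (x, y, b)] ++ (u ++ winv u)) [:: (x, y, b)]).
    apply: (@weq_cat _ [:: (x, y, b)] _ [::]); last exact: IHu.
    exact: we_refl.
  exact: we_refl.
by apply: we_cancel; apply: valP.
Qed.

Lemma winvK : involutive winv.
Proof.
move=> u; rewrite /winv map_rev revK -map_comp -[RHS]map_id.
by apply: eq_map => -[[x y] b] /=; rewrite negbK.
Qed.

Lemma weq_mulVw u : weq (winv u ++ u) [::].
Proof. by rewrite -{2}[u]winvK; apply: weq_mulV. Qed.

Lemma weq_inv u v : weq u v -> weq (winv u) (winv v).
Proof.
move=> uv; have refl w : weq w w by apply: we_refl.
apply: (@we_trans _ _ _ (word_emb (winv u ++ (v ++ winv v)))).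
  rewrite -{1}[winv u]cats0; apply: weq_cat (refl _) _.
  exact/we_sym/weq_mulV.
rewrite catA -[X in wedge_eq _ _ X]/(word_emb ([::] ++ winv v)).
apply: weq_cat (refl _).
apply: we_trans (weq_mulVw u); apply: weq_cat (refl _) _.
exact: we_sym.
Qed.

Lemma wconj_cat g u v : wconj g (u ++ v) = wconj g u ++ wconj g v.
Proof. exact: map_cat. Qed.

Lemma wconj1 u : wconj 1 u = u.
Proof.
rewrite -[RHS]map_id; apply: eq_map => -[[x y] b].
by rewrite /letter_conj /= !lconjE invg1 !conjg1.
Qed.

Lemma wconjM g h u : wconj (g * h) u = wconj g (wconj h u).
Proof.
rewrite /wconj -map_comp; apply: eq_map => -[[x y] b].
by rewrite /letter_conj /= !lconjE invMg !conjgM.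
Qed.

(* The semidirect product of the exterior square with [G]: the pair [(u, g)]
   stands for the class of the word [u] followed by [g]. *)
Definition pre_mul (a b : word * H) := (a.1 ++ wconj a.2 b.1, a.2 * b.2).
Definition pre_inv (a : word * H) := (wconj a.2^-1 (winv a.1), a.2^-1).
Definition pre_eq (a b : word * H) := `[< weq a.1 b.1 >] && (a.2 == b.2).

Lemma pre_eqP a b : reflect (weq a.1 b.1 /\ a.2 = b.2) (pre_eq a b).
Proof.
by apply: (iffP andP) => -[]; [move=> /asboolP ? /eqP | move=> /asboolP ? ->].
Qed.

Lemma pre_eq_refl : reflexive pre_eq.
Proof. by move=> a; apply/pre_eqP; split=> //; apply: we_refl. Qed.

Lemma pre_eq_sym : symmetric pre_eq.
Proof.
by move=> a b; apply/pre_eqP/pre_eqP => -[ab ->]; split=> //; apply: we_sym.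
Qed.

Lemma pre_eq_trans : transitive pre_eq.
Proof.
move=> b a c /pre_eqP[ab ab2] /pre_eqP[bc bc2]; apply/pre_eqP.
by split; [apply: we_trans ab bc | rewrite ab2].
Qed.

Canonical pre_equiv := EquivRel pre_eq pre_eq_refl pre_eq_sym pre_eq_trans.
Definition wedge_sd := {eq_quot pre_equiv}%qT.
HB.instance Definition _ := Choice.on wedge_sd.

Definition sd_class (a : word * H) : wedge_sd := (\pi_(wedge_sd) a)%qT.
Definition sd_mul (x y : wedge_sd) := sd_class (pre_mul (repr x) (repr y)).
Definition sd_inv (x : wedge_sd) := sd_class (pre_inv (repr x)).
Definition sd_one := sd_class ([::], 1).

Lemma sd_classP a b : sd_class a = sd_class b <-> weq a.1 b.1 /\ a.2 = b.2.
Proof. by split=> [/eqmodP/pre_eqP | E]; [|apply/eqmodP/pre_eqP]. Qed.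

Lemma sd_reprK x : sd_class (repr x) = x.
Proof. exact: reprK. Qed.

Lemma sd_repr a : weq (repr (sd_class a)).1 a.1 /\ (repr (sd_class a)).2 = a.2.
Proof. by apply/sd_classP; rewrite sd_reprK. Qed.

Lemma sd_mulE a b : sd_mul (sd_class a) (sd_class b) = sd_class (pre_mul a b).
Proof.
have [[a1 a2] [b1 b2]] := (sd_repr a, sd_repr b).
apply/sd_classP; rewrite /= a2 b2; split=> //.
by apply: weq_cat a1 _; apply: weq_conj.
Qed.

Lemma sd_invE a : sd_inv (sd_class a) = sd_class (pre_inv a).
Proof.
have [a1 a2] := sd_repr a; apply/sd_classP; rewrite /= a2; split=> //.
by apply/weq_conj/weq_inv.
Qed.

Lemma sd_mulA : associative sd_mul.
Proof.
move=> x y z; rewrite -[x]sd_reprK -[y]sd_reprK -[z]sd_reprK !sd_mulE.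
by congr sd_class; rewrite /pre_mul /= wconj_cat wconjM catA mulgA.
Qed.

Lemma sd_mul1 : left_id sd_one sd_mul.
Proof.
move=> x; rewrite -[x]sd_reprK sd_mulE; congr sd_class.
by rewrite /pre_mul /= wconj1 mul1g -surjective_pairing.
Qed.

Lemma sd_mulx1 : right_id sd_one sd_mul.
Proof.
move=> x; rewrite -[x]sd_reprK sd_mulE; congr sd_class.
by rewrite /pre_mul /= cats0 mulg1 -surjective_pairing.
Qed.

Lemma sd_mulVx : left_inverse sd_one sd_inv sd_mul.
Proof.
move=> x; rewrite -[x]sd_reprK sd_invE sd_mulE; apply/sd_classP.
rewrite /= mulVg; split=> //; rewrite -wconj_cat.
exact: (weq_conj _ (weq_mulVw _)).
Qed.

Lemma sd_mulxV : right_inverse sd_one sd_inv sd_mul.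
Proof.
move=> x; rewrite -[x]sd_reprK sd_invE sd_mulE; apply/sd_classP.
by rewrite /= mulgV -wconjM mulgV wconj1; split=> //; apply: weq_mulV.
Qed.

HB.instance Definition _ := isGroup.Build wedge_sd
  sd_mulA sd_mul1 sd_mulx1 sd_mulVx sd_mulxV.

Definition sd_group g : wedge_sd := sd_class ([::], g).
Definition sd_wedge g h : wedge_sd := sd_class ([:: gen g h], 1).
Definition sd_val (x : wedge_sd) := word_val (repr x).1 * (repr x).2.

Lemma sd_classM a b : sd_class a * sd_class b = sd_class (pre_mul a b).
Proof. exact: sd_mulE. Qed.

Lemma pre_mul1 u v g : pre_mul (u, 1) (v, g) = (u ++ v, g).
Proof. by rewrite /pre_mul wconj1 mul1g. Qed.

Lemma sd_classV a : (sd_class a)^-1 = sd_class (pre_inv a).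
Proof. exact: sd_invE. Qed.

Lemma val_word_val u : val (word_val u) = word_val (word_emb u).
Proof.
elim: u => [|[[x y] b] u IHu] //.
change (val (letter_val (x, y, b)) * val (word_val u) =
  letter_val (val x, val y, b) * word_val (word_emb u)).
by rewrite IHu; case: b.
Qed.

Lemma sd_valE a : sd_val (sd_class a) = word_val a.1 * a.2.
Proof.
have [a1 a2] := sd_repr a; rewrite /sd_val a2; congr (_ * _).
by apply: val_inj; rewrite !val_word_val; apply: word_val_eq a1.
Qed.

Lemma word_val_conj g u : word_val (wconj g u) = word_val u ^ g^-1.
Proof.
elim: u => [|[[x y] b] u IHu] /=; first by rewrite conj1g.
rewrite conjMg -IHu; congr (_ * _); rewrite /letter_val /= !lconjE.
by case: b => /=; free_group.
Qed.

Lemma sd_groupM : {morph sd_group : g h / g * h}.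
Proof. by move=> g h; rewrite sd_classM. Qed.

Lemma sd_groupV g : (sd_group g)^-1 = sd_group g^-1.
Proof. by rewrite sd_classV. Qed.

Lemma sd_valM : {morph sd_val : x y / x * y}.
Proof.
move=> x y; rewrite -[x]sd_reprK -[y]sd_reprK sd_classM !sd_valE /=.
by rewrite word_val_cat word_val_conj; free_group.
Qed.

Lemma sd_groupK : cancel sd_group sd_val.
Proof. by move=> g; rewrite sd_valE mul1g. Qed.

Lemma sd_val_wedge g h : sd_val (sd_wedge g h) = g * h * g^-1 * h^-1.
Proof. by rewrite sd_valE /= !mulg1. Qed.

Lemma sd_wedgeJV g h x :
  sd_wedge g h ^ (sd_group x)^-1 = sd_wedge (g ^ x^-1) (h ^ x^-1).
Proof.
rewrite conjgE invgK sd_groupV (sd_classM ([:: gen g h], 1)) (sd_classM ([::], x)).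
congr sd_class.
by rewrite /pre_mul /= mul1g mulgV /letter_conj /= !lconjE.
Qed.

Lemma sd_wedgeJ g h x : sd_wedge g h ^ sd_group x = sd_wedge (g ^ x) (h ^ x).
Proof. by rewrite -[sd_group x]invgK sd_groupV sd_wedgeJV invgK. Qed.

Lemma sd_wedgeMl x x' y :
  sd_wedge (x * x') y = sd_wedge x' y ^ (sd_group x)^-1 * sd_wedge x y.
Proof.
rewrite sd_wedgeJV (sd_classM ([:: _], 1) ([:: _], 1)) pre_mul1.
apply/sd_classP; split=> //=.
rewrite -!lconjE.
by apply: we_left; apply: valP.
Qed.

Lemma sd_wedgeMr x y y' :
  sd_wedge x (y * y') = sd_wedge x y * sd_wedge x y' ^ (sd_group y)^-1.
Proof.
rewrite sd_wedgeJV (sd_classM ([:: _], 1) ([:: _], 1)) pre_mul1.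
apply/sd_classP; split=> //=.
rewrite -!lconjE.
by apply: we_right; apply: valP.
Qed.

Lemma sd_wedgexx x : sd_wedge x x = 1.
Proof. by apply/sd_classP; split=> //; apply: we_diag; apply: valP. Qed.

Lemma sd_word_in (Q : wedge_sd -> Prop) : subgroup Q ->
  (forall x y, Q (sd_wedge x y)) -> forall u, Q (sd_class (u, 1)).
Proof.
move=> sQ Qt; elim=> [|[[x y] b] u IHu]; first exact: (sub1 sQ).
have -> : sd_class ((x, y, b) :: u, 1) = sd_class ([:: (x, y, b)], 1) * sd_class (u, 1).
  by rewrite sd_classM pre_mul1.
apply: (subM sQ) IHu; case: b; last exact: Qt.
suffices -> : sd_class ([:: (x, y, true)], 1) = (sd_wedge x y)^-1.
  exact/(subV sQ)/Qt.
by rewrite (sd_classV ([:: _], 1)) /pre_inv invg1 wconj1.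
Qed.

Lemma sd_gen (Q : wedge_sd -> Prop) : subgroup Q ->
  (forall x y, Q (sd_wedge x y)) -> (forall g, Q (sd_group g)) ->
  forall x, Q x.
Proof.
move=> sQ Qt Qg x; rewrite -[x]sd_reprK; case: (repr x) => u g.
have -> : sd_class (u, g) = sd_class (u, 1) * sd_group g.
  by rewrite sd_classM pre_mul1 cats0.
by apply: (subM sQ) (Qg g); apply: sd_word_in.
Qed.

Lemma sd_classX u n : sd_class (u, 1) ^+ n = sd_class (wpow u n, 1).
Proof.
elim: n => [|n IHn] //.
by rewrite expgS IHn sd_classM pre_mul1.
Qed.

Lemma wedge_word_emb (w : seq (letter gT)) : wedge_word G w -> exists u, w = word_emb u.
Proof.
elim: w => [|[[x y] b] w IHw] /=; first by exists [::].
case/andP=> /andP[Gx Gy] /IHw[u ->].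
by exists ((subg G x, subg G y, b) :: u); rewrite /= !subgK.
Qed.

Lemma wpow_trivial (w : seq (letter gT)) n :
  (forall x, wedge_lcn sd_wedge 0 x -> x ^+ n = 1) ->
  wedge_word G w -> wedge_eq G (wpow w n) [::].
Proof.
move=> Wn /wedge_word_emb[u ->].
have Wu : wedge_lcn sd_wedge 0 (sd_class (u, 1)).
  by apply: sd_word_in; [apply: subgroup_wedge_lcn | apply: wedge_in_lcn0].
have := Wn _ Wu; rewrite sd_classX => /sd_classP[] /=.
by rewrite /weq /word_emb /wpow map_flatten map_nseq.
Qed.

End WedgeGroup.

(** * The exponent of the exterior square *)

Lemma exponent_wedge p (gT : finGroupType) (G : {group gT}) :
  prime p -> odd p -> p.-group G ->
  (exists m, [/\ 2 <= m, m <= p - 1 & 'L_m(G) \subset powsub G p])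
    \/ 'L_p(G) \subset powsub G (p ^ 2) ->
  forall x, wedge_lcn (@sd_wedge gT G) 0 x -> x ^+ exponent G = 1.
Proof.
move=> p_pr p_odd pG hyp.
have [e eE] : exists e, exponent G = (p ^ e)%N.
  have [n En] := p_natP pG.
  have /(dvdn_pfactor _ _ p_pr)[e _ ->] : exponent G %| p ^ n.
    by rewrite -En exponent_dvdn.
  by exists e.
have Hx (x : subg_of G) : x ^+ (p ^ e) = 1.
  apply: val_inj; rewrite -eE.
  have -> : val (x ^+ exponent G) = val x ^+ exponent G by rewrite -morphX ?inE.
  by apply: expg_exponent; apply: valP.
have /lcnP[K LK] := pgroup_nil pG.
have gt2 := odd_prime_gt2 p_odd p_pr.
have tM := @sd_wedgeMl _ G; have iM := @sd_groupM _ G.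
have cW := wedge_lcn_series iM (@sd_valM _ G) (@sd_groupK _ G) (@sd_val_wedge _ G)
  (@sd_wedgeJ _ G) tM (@sd_wedgeMr _ G) (@sd_wedgexx _ G) (@sd_gen _ G).
have gW := wedge_lcn_gen iM (@sd_valM _ G) (@sd_groupK _ G) (@sd_val_wedge _ G)
  (@sd_wedgeJ _ G) tM (@sd_wedgeMr _ G) (@sd_wedgexx _ G) (@sd_gen _ G).
have shW := wedge_lcn_shifts iM (@sd_valM _ G) (@sd_groupK _ G) (@sd_val_wedge _ G)
  (@sd_wedgeJ _ G) tM (@sd_wedgeMr _ G) (@sd_gen _ G).
have nW := wedge_lcn_nil iM tM LK.
have eW k := wedge_lcn_generators iM tM (k := k) Hx.
rewrite eE => x; case: hyp => [[m [m2 mp Lm]] | Lp] Wx.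
  (* This is gamma_(p-1)(G), contained in gamma_m(G) as m <= p - 1. *)
  have L : 'L_(p - 2).+1(G) \subset powsub G p.
    by apply: subset_trans (lcn_sub_leq _ _) Lm; lia.
  apply: (exp_case1 p_pr p_odd cW gW shW nW eW _ Wx).
  exact: (wedge_lcn_seeds iM (@sd_wedgeJ _ G) tM Hx L).
have L : 'L_(p - 1).+1(G) \subset powsub G (p ^ 2).
  by rewrite subn1 prednK ?prime_gt0.
apply: (exp_case2 p_pr p_odd cW gW shW nW eW _ Wx).
exact: (wedge_lcn_seeds iM (@sd_wedgeJ _ G) tM Hx L).
Qed.

Local Close Scope group_scope.
Unset Implicit Arguments.

Theorem theorem4p9 (p : nat) (gT : finGroupType) (G : {group gT}) :
  prime p -> odd p -> (p.-group G)%g ->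
  ((exists m : nat, [/\ 2 <= m, m <= p - 1 & ('L_m(G) \subset powsub G p)%g])
   \/ ('L_p(G) \subset powsub G (p ^ 2))%g) ->
  (forall w : seq (letter gT), wedge_word G w ->
     wedge_eq G (wpow w (exponent G)) [::]) /\
  (forall w : seq (letter gT), wedge_word G w -> word_val w = 1%g ->
     wedge_eq G (wpow w (exponent G)) [::]).
Proof.
move=> p_pr p_odd pG hyp; have expW := exponent_wedge p_pr p_odd pG hyp.
by split=> [w | w Gw _]; apply: wpow_trivial.
Qed.
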